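(* Let $S_3\subseteq\mathbb{R}^2$ be the chainable continuum $$S_3=\bigcup_{n\in\mathbb{N}}I_n\cup\bigcup_{n\in\mathbb{N}}A_n\cup\{(0,0)\},$$ where $I_n=\{\frac1n\}\times[0,\frac1n]$ and $$A_n=\Big\{\Big(x,\Big|x\cdot\sin\Big(\frac{1}{(x-\frac{1}{n+1})(\frac1n-x)}\Big)\Big|\Big):x\in\big(\tfrac{1}{n+1},\tfrac1n\big)\Big\}.$$ There exist exactly $\mathfrak{c}$ distinct ultrafilter orders on $S_3$, where $\mathfrak{c}=2^{\aleph_0}$.
   Context: A continuum is a compact connected metrizable space; fix a metric generating its topology. A chain in $X$ is a finite sequence of open sets $d_1,\dots,d_k$ (its links) with $d_i\cap d_j\neq\varnothing\iff|i-j|\le 1$; its mesh is the maximum of the diameters of its links. $X$ is chainable if for every $\varepsilon>0$ it is covered by a chain of mesh less than $\varepsilon$. $\mathbb{N}=\{1,2,3,\dots\}$. Let $\mathcal{D}=\{D_n\}_{n\in\mathbb{N}}$ be a sequence of chains $D_n=\{d_{1,n},\dots,d_{k_n,n}\}$, each covering $X$, with $\mathrm{mesh}(D_n)\to 0$, and let $\mathcal{U}$ be a non-principal ultrafilter on $\mathbb{N}$. Write $x\leq_{D_n}y$ iff there exist $i\le j\le k_n$ with $x\in d_{i,n}$ and $y\in d_{j,n}$, and $x\leq_{\mathcal{U}}^{\mathcal{D}}y$ iff $\{n\in\mathbb{N}: x\leq_{D_n}y\}\in\mathcal{U}$. This is a linear order on $X$. An ultrafilter order on $X$ is any order of the form $\leq_{\mathcal{U}}^{\mathcal{D}}$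 for some such $\mathcal{D}$ and $\mathcal{U}$ (both are allowed to vary); two ultrafilter orders are distinct if they are different as relations on $X$. *)

(* Defs.v *)
From HB Require Import structures.
From mathcomp Require Import all_boot all_order all_algebra.
From mathcomp Require Import all_classical all_reals all_analysis.
Import Order.TTheory GRing.Theory Num.Theory.
Import numFieldNormedType.Exports.

Set Implicit Arguments.
Unset Strict Implicit.
Unset Printing Implicit Defensive.

Local Open Scope classical_set_scope.
Local Open Scope ring_scope.

Section UltrafilterOrders.
Context {R : realType} {X : topologicalType}.

(* The continua considered here are subspaces (as [set_type]s) whose topology
   is known but for which no metric is canonical in the library, so the chosen
   metric is an explicit function. *)
Definition generating_metric (d : X -> X -> R) : Prop :=
  [/\ forall x y, 0 <= d x y,
      forall x y, d x y = 0 <-> x = y,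
      forall x y, d x y = d y x,
      forall x y z, d x z <= d x y + d y z &
      forall x, nbhs x = filter_from [set e | 0 < e] (fun e => [set y | d x y < e])].

Definition diam (d : X -> X -> R) (A : set X) : \bar R :=
  ereal_sup [set (d x y)%:E | x in A & y in A].

(* Links are numbered from 0.  The case i = j of the second clause forces
   every link to be nonempty. *)
Definition is_chain (s : seq (set X)) : Prop :=
  (forall i, (i < size s)%N -> open (nth set0 s i)) /\
  (forall i j, (i < size s)%N -> (j < size s)%N ->
     (nth set0 s i `&` nth set0 s j !=set0) <-> `|i%:Z - j%:Z| <= 1).

Definition covers (s : seq (set X)) : Prop :=
  forall x, exists2 i, (i < size s)%N & nth set0 s i x.

Definition mesh (d : X -> X -> R) (s : seq (set X)) : \bar R :=
  \big[maxe/0%E]_(u <- s) diam d u.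

Definition chain_le (s : seq (set X)) (x y : X) : Prop :=
  exists i j, [/\ (i <= j)%N, (j < size s)%N, nth set0 s i x & nth set0 s j y].

(* The sequence of chains is indexed from 0 rather than from 1; shifting the
   index is a bijection that carries ultrafilters to ultrafilters. *)
Definition ultra_le (D : nat -> seq (set X)) (U : set_system nat) (x y : X) :
    Prop :=
  U [set n | chain_le (D n) x y].

Definition ultrafilter_orders (d : X -> X -> R) : set (X -> X -> Prop) :=
  [set r | exists (D : nat -> seq (set X)) (U : set_system nat),
    [/\ forall n, is_chain (D n) /\ covers (D n),
        mesh d (D n) @[n --> \oo] --> 0%E,
        UltraFilter U,
        forall n, U <> principal_filter n &
        r = ultra_le D U]].

End UltrafilterOrders.

Section S3.
Variable R : realType.

Definition S3_I (n : nat) : set (R * R) :=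
  [set n%:R^-1] `*` [set y | 0 <= y <= n%:R^-1].

Definition S3_A (n : nat) : set (R * R) :=
  [set (x, `|x * sin (1 / ((x - n.+1%:R^-1) * (n%:R^-1 - x)))|) |
    x in [set x | n.+1%:R^-1 < x < n%:R^-1]].

Definition S3 : set (R * R) :=
  (\bigcup_(n in [set n | (0 < n)%N]) S3_I n) `|`
  (\bigcup_(n in [set n | (0 < n)%N]) S3_A n) `|` [set (0, 0)].

End S3.

Arguments S3 : clear implicits.

(* Main.v *)
Require Import Defs.
From HB Require Import structures.
From mathcomp Require Import all_boot all_order all_algebra.
From mathcomp Require Import all_classical all_reals all_analysis.
From mathcomp Require Import zify ring lra.
Import Order.TTheory GRing.Theory Num.Theory.
Import numFieldNormedType.Exports.

Local Open Scope classical_set_scope.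
Local Open Scope ring_scope.


Set Implicit Arguments.
Unset Strict Implicit.
Unset Printing Implicit Defensive.

(** The bars [S3_I n] and the arcs [S3_A n] follow one another along the first
    axis, and an ultrafilter order can only choose a direction for the whole
    sequence and a direction for every single bar; all choices for the bars
    occur.

    Upper bound.  If a continuum [C] avoids a point [x], then a link of fine mesh
    that contains [x] misses [C], whereas [C] meets every link between two links
    that it meets.  Hence [C] lies on one side of [x] ([ultra_side]), and a point
    [q] lies between [p] and [s] as soon as there are a continuum through [p] and
    [q] that avoids [s] and one through [q] and [s] that avoids [p]
    ([ultra_between]).  In the present space such continua are the slabs cut out
    by conditions on the first coordinate ([connected_slab]) and the subsegments
    of the bars.  An order is therefore determined by its comparison of the
    origin with [(1, 0)] and of the two ends of each bar ([order_determined]), so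
    that there are at most as many orders as sets of natural numbers.

    Lower bound.  A continuous function on a compact connected space whose
    fibers are small pulls chains of short intervals back to chains of small mesh
    ([close_of_small_value], [pullback_chain]).  Near a bar the arcs oscillate
    between the axis and the diagonal, so there are arbitrarily thin slabs around
    the bar whose left and right faces meet the space at relative heights 0 and 1,
    or 1 and 0, as one likes ([good_slab_exists]).  Letting a function grow with
    the relative height, or with its complement to 1, inside the slabs around the
    first [N] bars, and with the first coordinate everywhere, gives a continuous
    function with small fibers that runs through these bars in prescribed
    directions ([ladder], [ladder_fiber], [ladder_bar]).  The resulting chains
    realize every sequence of directions by an ultrafilter order
    ([chain_with_bars], [card_orders_ge]). *)

(** * Ultrafilter orders and continua *)

Lemma nonprincipal_cofinite (U : set_system nat) (m : nat) :
  UltraFilter U -> (forall n, U <> principal_filter n) ->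
  U [set n | (m <= n)%N].
Proof.
move=> UU Un; have UF : Filter U by apply: ultra_proper.
have U1 n : U (~` [set n]).
  have [Us|//] := in_ultra_setVsetC [set n] UU.
  exfalso; apply: (Un n); apply/seteqP; split=> A.
    move=> UA; apply/principal_filterP; have : U (A `&` [set n]) by exact: filterI.
    have UPF : ProperFilter U by apply: ultra_proper.
    by move=> /filter_ex[k [Ak /= kn]]; rewrite -kn.
  move/principal_filterP => An; apply: filterS Us => k /= ->//.
elim: m => [|m IH].
  by apply: filterS filterT.
apply: filterS (filterI IH (U1 m)) => k /= [mk km].
by rewrite ltn_neqAle mk andbT; apply/eqP => mk'; apply: km.
Qed.

Section UltraOrders.
Context (R : realType) (X : topologicalType) (d : X -> X -> R).
Hypothesis hd : generating_metric d.

Lemma link_le_mesh (s : seq (set X)) i x y : (i < size s)%N ->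
  nth set0 s i x -> nth set0 s i y -> ((d x y)%:E <= mesh d s)%E.
Proof.
move=> si sx sy; rewrite /mesh.
have : (diam d (nth set0 s i) <= \big[maxe/0%E]_(u <- s) diam d u)%E.
  by apply: le_bigmax_seq => //; exact: mem_nth.
apply: le_trans; apply: ereal_sup_ubound => /=.
by exists x => //; exists y.
Qed.

(** Non-adjacent links are disjoint, so a link missed by a connected set cuts
    that set into two relatively open pieces. *)
Lemma connected_meets_links (s : seq (set X)) (C : set X) i j k y z :
  is_chain s -> covers s -> connected C -> (i <= j <= k)%N -> (k < size s)%N ->
  C y -> nth set0 s i y -> C z -> nth set0 s k z ->
  exists2 c, C c & nth set0 s j c.
Proof.
move=> [so sI] sC cC /andP[ij jk] ks Cy iy Cz kz.
apply: contrapT => Cj.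
have nCj c : C c -> nth set0 s j c -> False by move=> ? ?; apply: Cj; exists c.
have ij' : (i < j)%N.
  by rewrite ltn_neqAle ij andbT; apply/eqP => E; apply: (nCj y) => //; rewrite -E.
have jk' : (j < k)%N.
  by rewrite ltn_neqAle jk andbT; apply/eqP => E; apply: (nCj z) => //; rewrite E.
pose lo := \bigcup_(l in [set l | (l < j)%N]) nth set0 s l.
pose hi := \bigcup_(l in [set l | (j < l < size s)%N]) nth set0 s l.
have olo : open lo by apply: bigcup_open => l /= lj; apply: so; lia.
have ohi : open hi by apply: bigcup_open => l /= lj; apply: so; lia.
have disj l l' p : (l < j)%N -> (j < l')%N -> (l' < size s)%N ->
    nth set0 s l p -> nth set0 s l' p -> False.
  move=> lj jl' l's pl pl'.
  have ls : (l < size s)%N by lia.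
  have [/(_ (ex_intro _ p (conj pl pl'))) H _] := sI l l' ls l's; lia.
have CE : C `&` lo = C.
  apply: cC; first by exists y; split=> //; exists i.
    by exists lo.
  exists (~` hi); first exact: open_closedC.
  apply/seteqP; split=> p [Cp].
    move=> [l /= lj lp]; split=> // -[l' /= /andP[jl' l's] l'p].
    exact: (disj l l' p).
  move=> hp; split=> //; have [l ls lp] := sC p.
  have [lj|jl|E] := ltngtP l j; first by exists l.
    by exfalso; apply: hp; exists l => //=; rewrite jl.
  by exfalso; apply: (nCj p Cp); rewrite -E.
have [_ [l /= lj lz]] : (C `&` lo) z by rewrite CE.
exact: (disj l k z).
Qed.

Lemma closed_dist (C : set X) x : closed C -> ~ C x ->
  exists2 e : R, 0 < e & forall c, C c -> e <= d x c.
Proof.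
have [_ _ _ _ nb] := hd; move=> cC Cx.
have : nbhs x (~` C) by apply: open_nbhs_nbhs; split => //; exact: closed_openC.
rewrite nb => -[e /= e0 eC]; exists e => // c Cc.
by rewrite leNgt; apply/negP => /eC; apply.
Qed.

Variable r : X -> X -> Prop.
Hypothesis hr : ultrafilter_orders d r.

Lemma ultra_total x y : r x y \/ r y x.
Proof.
have [D [U [Dch _ UU Un ->]]] := hr; rewrite /ultra_le.
have UF : Filter U by apply: ultra_proper.
have [|H] := in_ultra_setVsetC [set n | chain_le (D n) x y] UU; first by left.
right; apply: filterS H => n /= H.
have [[_ _] sC] := Dch n; have [i si ix] := sC x; have [j sj jy] := sC y.
have [ij|ji] := leqP i j; first by exfalso; apply: H; exists i, j.
by exists j, i; split=> //; exact: ltnW.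
Qed.

Lemma ultra_mesh (D : nat -> seq (set X)) (U : set_system nat) (e : R) :
  mesh d (D n) @[n --> \oo] --> 0%E -> UltraFilter U ->
  (forall n, U <> principal_filter n) -> 0 < e ->
  U [set n | (mesh d (D n) < e%:E)%E].
Proof.
move=> mD UU Un e0; have UF : Filter U by apply: ultra_proper.
have /mD [m _ mP] : nbhs (0%E : \bar R) [set z | (z < e%:E)%E].
  by apply: open_nbhs_nbhs; split; [exact: open_ereal_lt_ereal|rewrite /= lte_fin].
by apply: filterS (nonprincipal_cofinite m UU Un) => n; exact: mP.
Qed.

Lemma ultra_antisym x y : r x y -> r y x -> x = y.
Proof.
have [D [U [Dch mD UU Un ->]]] := hr; rewrite /ultra_le => Uxy Uyx.
have [d0 dE dC dT _] := hd.
have UF : ProperFilter U by apply: ultra_proper.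
apply: contrapT => xy.
have dxy : 0 < d x y.
  by rewrite lt_neqAle d0 andbT eq_sym; apply/eqP => /dE.
have Um := ultra_mesh (e := d x y / 2) mD UU Un ltac:(lra).
have [n [[[i [j [ij sj ix jy]]] [i' [j' [ij' sj' i'y j'x]]]] /= me]] :=
  filter_ex (filterI (filterI Uxy Uyx) Um).
have small l p q : (l < size (D n))%N -> nth set0 (D n) l p ->
    nth set0 (D n) l q -> d p q < d x y / 2.
  by move=> ls lp lq; rewrite -lte_fin; apply: le_lt_trans me; exact: link_le_mesh lp lq.
have far l : (l < size (D n))%N -> nth set0 (D n) l x ->
    nth set0 (D n) l y -> False.
  by move=> ls lx ly; have := small l x y ls lx ly; lra.
have [[_ sI] _] := Dch n.
have far2 l l' : (l < size (D n))%N -> (l' < size (D n))%N ->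
    `|l%:Z - l'%:Z| <= 1 -> nth set0 (D n) l x -> nth set0 (D n) l' y -> False.
  move=> ls ls' ll' lx l'y; have [_ /(_ ll') [z [lz l'z]]] := sI l l' ls ls'.
  have := small l x z ls lx lz; have := small l' z y ls' l'z l'y.
  by have := dT x z y; lra.
have is_ : (i < size (D n))%N by lia.
have is'_ : (i' < size (D n))%N by lia.
have [/(_ (ex_intro _ x (conj ix j'x))) Ex _] := sI i j' is_ sj'.
have [/(_ (ex_intro _ y (conj jy i'y))) Ey _] := sI j i' sj is'_.
have [E|E] := leqP j i.+1.
  by apply: (far2 i j) => //; lia.
have E' : i' = j' by lia.
by apply: (far i') => //; rewrite E'.
Qed.

(** A link of fine mesh around [x] does not meet [C], whereas [C] meets every
    link between two links that it meets. *)
Lemma ultra_side_lt (C : set X) x y z : closed C -> connected C -> ~ C x ->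
  C y -> C z -> r y x -> r z x.
Proof.
have [D [U [Dch mD UU Un ->]]] := hr; rewrite /ultra_le.
have UF : ProperFilter U by apply: ultra_proper.
move=> clC coC Cx Cy Cz Uyx.
have [e e0 eC] := closed_dist clC Cx.
apply: filterS (filterI Uyx (ultra_mesh mD UU Un e0)) => n.
move=> [[i [j [ij sj iy jx]]] /= me].
have [chD coD] := Dch n.
have [k sk kz] := coD z.
have [kj|jk] := leqP k j; first by exists k, j.
have [|c Cc jc] := @connected_meets_links (D n) C i j k y z chD coD coC _ sk Cy iy Cz kz.
  by rewrite ij ltnW.
have : (e%:E < e%:E)%E.
  apply: le_lt_trans me; apply: le_trans (link_le_mesh sj jx jc).
  by rewrite lee_fin eC.
by rewrite ltxx.
Qed.

(** A continuum lies entirely on one side of each point outside it. *)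
Lemma ultra_side (C : set X) x y z : closed C -> connected C -> ~ C x ->
  C y -> C z -> (r y x <-> r z x) /\ (r x y <-> r x z).
Proof.
move=> clC coC Cx Cy Cz.
have gt u v : C u -> C v -> r x u -> r x v.
  move=> Cu Cv xu; have [//|vx] := ultra_total x v.
  have ux := ultra_side_lt clC coC Cx Cv Cu vx.
  by exfalso; apply: Cx; rewrite (ultra_antisym xu ux).
by split; split; [exact: ultra_side_lt Cy Cz|exact: ultra_side_lt Cz Cy|
  exact: gt|exact: gt].
Qed.

(** Seen from [s], the points [p] and [q] lie on one side; seen from [p], so do
    [q] and [s]. *)
Lemma ultra_between (C1 C2 : set X) p q s :
  closed C1 -> connected C1 -> closed C2 -> connected C2 ->
  C1 p -> C1 q -> ~ C1 s -> C2 q -> C2 s -> ~ C2 p ->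
  (r p q <-> r q s) /\ (r p q <-> r p s).
Proof.
move=> cl1 co1 cl2 co2 p1 q1 s1 q2 s2 p2.
have [Es _] := ultra_side cl1 co1 s1 p1 q1.
have [_ Ep] := ultra_side cl2 co2 p2 q2 s2.
by rewrite Ep Es.
Qed.

End UltraOrders.

(** * The continuum and its vertical slabs *)

Section Geometry.
Variable R : realType.
Implicit Types (p q : R * R) (n : nat).

Lemma fst_continuous (T U : topologicalType) : continuous (@fst T U).
Proof. by move=> p; exact: cvg_fst. Qed.

Lemma snd_continuous (T U : topologicalType) : continuous (@snd T U).
Proof. by move=> p; exact: cvg_snd. Qed.

Definition phase (n : nat) (x : R) : R :=
  (x - n.+1%:R^-1) * (n%:R^-1 - x).

Definition wave (n : nat) (x : R) : R := `|sin (1 / phase n x)|.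

Lemma waveM n (x : R) : 0 <= x -> `|x * sin (1 / phase n x)| = x * wave n x.
Proof. by move=> x0; rewrite normrM ger0_norm. Qed.

Lemma wave_itv n x : 0 <= wave n x <= 1.
Proof. by rewrite normr_ge0 /= ler_norml sin_geN1 sin_le1. Qed.

Lemma invn_ltE m n : (0 < m)%N -> (0 < n)%N ->
  (n%:R^-1 < m%:R^-1 :> R) = (m < n)%N.
Proof. by move=> m0 n0; rewrite ltf_pV2 ?ltr_nat// posrE ltr0n. Qed.

Lemma invn_le m n : (0 < m)%N -> (m <= n)%N -> n%:R^-1 <= m%:R^-1 :> R.
Proof.
by move=> m0 mn; rewrite lef_pV2 ?ler_nat// posrE ltr0n //; exact: leq_trans mn.
Qed.

Lemma invn_le1 n : (0 < n)%N -> n%:R^-1 <= 1 :> R.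
Proof. by move=> n0; rewrite invf_le1 ?ltr0n // ler1n. Qed.

Lemma invn_gt0 n : (0 < n)%N -> 0 < n%:R^-1 :> R.
Proof. by move=> n0; rewrite invr_gt0 ltr0n. Qed.

Lemma invn_bracket (x : R) : 0 < x <= 1 ->
  exists2 n, (0 < n)%N & n.+1%:R^-1 < x <= n%:R^-1.
Proof.
move=> /andP[x0 x1]; have xV0 : 0 <= x^-1 by rewrite invr_ge0 ltW.
have /andP[le1 lt1] := truncn_itv xV0.
have t0 : (0 < Num.truncn x^-1)%N by rewrite truncn_gt0 invf_ge1.
exists (Num.truncn x^-1) => //.
apply/andP; split.
  by rewrite -[ltRHS]invrK ltf_pV2 // posrE ?invr_gt0 ?ltr0n.
by rewrite -[leLHS]invrK lef_pV2 // posrE ?invr_gt0 ?ltr0n.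
Qed.

Lemma invn_between n k : (0 < n)%N -> (0 < k)%N ->
  n.+1%:R^-1 < (k%:R^-1 : R) < n%:R^-1 -> False.
Proof.
move=> n0 k0 /andP[]; rewrite !invn_ltE //; lia.
Qed.

(** The closed conditions describing the continuum: only over the open
    intervals between consecutive unit fractions is the height determined. *)
Lemma S3P p : S3 R p <-> [/\ 0 <= p.1 <= 1, 0 <= p.2 <= p.1 &
  forall n, (0 < n)%N -> n.+1%:R^-1 < p.1 < n%:R^-1 -> p.2 = p.1 * wave n p.1].
Proof.
split.
  case; last first.
    move=> -> /=; rewrite ler01 lexx; split=> // n n0 /andP[h _].
    by move: h; rewrite ltNge ltW ?invn_gt0.
  case=> [[n /= n0 [/= -> pn]]|[n /= n0 [x /= /andP[x1 x2] <-]]].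
    split=> //.
      by rewrite invr_ge0 ler0n /= invn_le1.
    by move=> m m0 /(invn_between m0 n0).
  have x0 : 0 < x by apply: lt_trans x1; apply: invn_gt0.
  have xle1 : x <= 1.
    by apply: (le_trans (ltW x2)); apply: invn_le1.
  rewrite -/(phase n x) waveM ?(ltW x0) //=.
  have /andP[w0 w1] := wave_itv n x; split.
  - exact: xle1.
  - by rewrite mulr_ge0 ?(ltW x0) //= ler_piMr // ltW.
  - move=> m m0 /andP[m1 m2]; suff -> : m = n by [].
    have := lt_trans x1 m2; have := lt_trans m1 x2.
    rewrite !invn_ltE //; lia.
case: p => x y /= [/andP[x0 x1] /andP[y0 yx] W].
have [xz|xz] := eqVneq x 0.
  by right => /=; move: yx; rewrite xz => yx; congr pair; lra.
have xp : 0 < x by rewrite lt_neqAle eq_sym xz.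
left; have [|n n0] := @invn_bracket x; first by rewrite xp.
move=> /andP[nx]; rewrite le_eqVlt => /orP[/eqP xn|xn].
  by left; exists n => //; split => //=; rewrite -xn y0.
right; exists n => //; exists x; first by rewrite /= nx.
by congr pair; rewrite -/(phase n x) waveM // (W n) // nx.
Qed.

Lemma phase_gt0 n x : n.+1%:R^-1 < x < n%:R^-1 -> 0 < phase n x.
Proof. by move=> /andP[? ?]; rewrite mulr_gt0 // subr_gt0. Qed.

Lemma phase_continuous n : continuous (phase n).
Proof.
move=> x; apply: cvgM.
  by apply: cvgB; [exact: cvg_id|exact: cvg_cst].
by apply: cvgB; [exact: cvg_cst|exact: cvg_id].
Qed.

Lemma wave_continuous n x : n.+1%:R^-1 < x < n%:R^-1 ->
  {for x, continuous (wave n)}.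
Proof.
move=> /phase_gt0 h; rewrite /continuous_at.
apply: cvg_norm; apply: continuous_cvg; first exact: continuous_sin.
apply: cvgM; first exact: cvg_cst.
by apply: cvgV; [rewrite gt_eqF|exact: phase_continuous].
Qed.

(** The conditions of [S3P] are closed, the last one because its negation,
    over an open interval on which the wave is continuous, is open. *)
Lemma closed_S3 : closed (S3 R).
Proof.
pose Bad n : set (R * R) := [set p | n.+1%:R^-1 < p.1 < n%:R^-1 /\
   p.2 - p.1 * wave n p.1 != 0].
have oBad n : open (Bad n).
  rewrite openE => p [pn pw].
  have c1 : \forall q \near p, n.+1%:R^-1 < q.1 < n%:R^-1.
    have : open [set q : R * R | n.+1%:R^-1 < q.1 < n%:R^-1].
      rewrite (_ : mkset _ = fst @^-1` (`]n.+1%:R^-1, n%:R^-1[ : set R)); last first.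
        by apply/seteqP; split=> q /=; rewrite in_itv.
      by apply: open_comp; [move=> ? _; exact: fst_continuous|exact: interval_open].
    by rewrite openE => /(_ p pn).
  have c2 : \forall q \near p, q.2 - q.1 * wave n q.1 != 0.
    have /(_ [set x | x != 0]) : (fun q => q.2 - q.1 * wave n q.1) @ p -->
        p.2 - p.1 * wave n p.1.
      apply: cvgB; first exact: snd_continuous.
      apply: cvgM; first exact: fst_continuous.
      exact: (cvg_comp _ _ (@fst_continuous _ _ p) (wave_continuous pn)).
    by apply; apply: open_nbhs_nbhs; split; [exact: open_neq|].
  by rewrite /interior; near=> q; split; near: q.
rewrite (_ : S3 R = [set p | 0 <= p.1] `&` [set p | p.1 <= 1] `&`
  [set p | 0 <= p.2] `&` [set p | 0 <= p.1 - p.2] `&`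
  \bigcap_(n in [set n | (0 < n)%N]) ~` Bad n); last first.
  apply/seteqP; split=> p.
    move=> /S3P[/andP[? ?] /andP[? ?] W]; split; last first.
      by move=> n /= n0 [pn]; rewrite (W n n0 pn) subrr eqxx.
    by do !split => //=; rewrite subr_ge0.
  move=> [[[[/= x0 x1] y0] yx] B]; apply/S3P; split.
  - by rewrite x0.
  - by rewrite y0 -subr_ge0.
  - move=> n n0 pn; apply/eqP; rewrite -subr_eq0; apply: contrapT => /negP h.
    exact: (B n n0).
have pre (f : R * R -> R) (A : set R) : continuous f -> closed A -> closed (f @^-1` A).
  by move=> cf; move/continuous_closedP : cf; apply.
repeat apply: closedI.
- exact: (pre fst _ (@fst_continuous _ _) (@closed_ge _ 0)).
- exact: (pre fst _ (@fst_continuous _ _) (@closed_le _ 1)).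
- exact: (pre snd _ (@snd_continuous _ _) (@closed_ge _ 0)).
- apply: (pre (fun p => p.1 - p.2) _ _ (@closed_ge _ 0)) => p.
  by apply: cvgB; [exact: fst_continuous|exact: snd_continuous].
- by apply: closed_bigI => n _; exact: open_closedC.
Unshelve. all: by end_near. Qed.

Lemma compact_S3 : compact (S3 R).
Proof.
apply: (@subclosed_compact _ _ ((`[0, 1]%classic : set R) `*` (`[0, 1]%classic : set R))).
- exact: closed_S3.
- by apply: compact_setX; exact: segment_compact.
- move=> p /S3P[/andP[? ?] /andP[? ?] _].
  by split; rewrite /= in_itv /=; apply/andP; split => //; lra.
Qed.

(** A separation of [K] would be a union of fibers on either side, and
    the images of its two compact pieces would separate [f @` K]. *)
Lemma connected_fibers (T : topologicalType) (f : T -> R) (K : set T) :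
  compact K -> continuous f -> connected (f @` K) ->
  (forall a, connected (K `&` f @^-1` [set a])) -> connected K.
Proof.
move=> cK cf cfK fib B B0 [V oV BV] [F clF BF].
have cimg A : closed A -> closed (f @` (K `&` A)).
  move=> clA; apply: compact_closed; first exact: Rhausdorff.
  apply: continuous_compact; first exact: continuous_subspaceT.
  exact: compact_closedI.
have sat x y : B x -> K y -> f x = f y -> B y.
  move=> Bx Ky xy.
  have [Kx _] : (K `&` V) x by rewrite -BV.
  suff E : (K `&` f @^-1` [set f y]) `&` B = K `&` f @^-1` [set f y].
    have [//] : ((K `&` f @^-1` [set f y]) `&` B) y by rewrite E.
  apply: (fib (f y)); first by exists x.
    by exists V => //; rewrite BV setIA [_ `&` K]setIC setIA setIid.
  by exists F => //; rewrite BF setIA [_ `&` K]setIC setIA setIid.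
have E : f @` B = f @` K.
  apply: cfK; first by case: B0 => x Bx; exists (f x), x.
    exists (~` (f @` (K `&` ~` V))).
      by apply: closed_openC; apply: cimg; exact: open_closedC.
    apply/seteqP; split=> t.
      move=> [x Bx <-]; split.
        by move: Bx; rewrite BV => -[Kx _]; exists x.
      move=> [y [Ky Vy] yx]; have := sat _ _ Bx Ky (esym yx).
      by rewrite BV => -[].
    move=> [[x Kx <-] h]; exists x => //; rewrite BV; split => //.
    by apply: contrapT => Vx; apply: h; exists x.
  exists (f @` (K `&` F)); first exact: cimg.
  rewrite -BF; apply/seteqP; split=> t; last by case.
  move=> [x Bx <-]; split; last by exists x.
  by move: Bx; rewrite BV => -[Kx _]; exists x.
apply/seteqP; split=> x; first by rewrite BV => -[].
move=> Kx; have [y By yx] : (f @` B) (f x) by rewrite E; exists x.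
exact: sat By Kx yx.
Qed.

Lemma connected_convex_fiber (a : R) (C : set (R * R)) :
  (forall y1 y y2, C (a, y1) -> C (a, y2) -> y1 <= y <= y2 -> C (a, y)) ->
  connected (C `&` fst @^-1` [set a]).
Proof.
move=> conv.
rewrite (_ : _ `&` _ = (fun y => (a, y)) @` [set y | C (a, y)]); last first.
  apply/seteqP; split=> [[x y] /= [Cxy <-]|_ [y /= Cy <-]//].
  by exists y.
apply: connected_continuous_connected.
  apply/connected_intervalP => y1 y2 C1 C2 y y12; exact: (conv y1 y y2).
apply: continuous_subspaceT => y.
exact: (@cvg_pair _ _ _ (nbhs y) (nbhs a) (nbhs y) _ _ _ (fun=> a) id (cvg_cst _) cvg_id).
Qed.

Lemma S3_over (x : R) : 0 <= x <= 1 -> exists y, S3 R (x, y).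
Proof.
move=> /andP[x0 x1].
have [xz|xz] := eqVneq x 0.
  by exists 0; right; rewrite xz.
have xp : 0 < x by rewrite lt_neqAle eq_sym xz.
have [|n n0] := @invn_bracket x; first by rewrite xp.
move=> /andP[nx]; rewrite le_eqVlt => /orP[/eqP xn|xn].
  exists 0; left; left; exists n => //; split => //=.
  by rewrite lexx invr_ge0 ler0n.
exists (x * wave n x); left; right; exists n => //; exists x; first by rewrite /= nx.
by rewrite -/(phase n x) waveM.
Qed.

Definition slab (a b : R) : set (R * R) := S3 R `&` [set p | a <= p.1 <= b].

Lemma closed_strip (a b : R) : closed [set p : R * R | a <= p.1 <= b].
Proof.
rewrite (_ : mkset _ = fst @^-1` (`[a, b] : set R)); last first.
  by apply/seteqP; split=> q /=; rewrite in_itv.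
have /continuous_closedP := @fst_continuous R R; apply; exact: itv_closed.
Qed.

Lemma closed_slab a b : closed (slab a b).
Proof. by apply: closedI; [exact: closed_S3|exact: closed_strip]. Qed.

(** A slab projects onto an interval, with single points and bars as fibers. *)
Lemma connected_slab a b : 0 <= a -> b <= 1 -> connected (slab a b).
Proof.
move=> a0 b1; apply: (@connected_fibers _ fst).
- by apply: (subclosed_compact (@closed_slab a b) (@compact_S3)) => ? [].
- exact: fst_continuous.
- rewrite (_ : _ @` _ = `[a, b]%classic); first exact: segment_connected.
  apply/seteqP; split=> [_ [p [_ /= pab] <-]|x]; rewrite /= in_itv //=.
  move=> /andP[ax xb]; have [|y S] := @S3_over x; first by apply/andP; split; lra.
  by exists (x, y) => //; split=> //=; rewrite ax.
- move=> x; apply: connected_convex_fiber => y1 y y2 [S1 /= xab] [S2 _] /andP[y1y yy2].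
  split=> //; move: S1 S2 => /S3P[/= h1 /andP[h2 h3] W1] /S3P[/= _ /andP[h4 h5] W2].
  apply/S3P; split=> //=; first by apply/andP; split; lra.
  by move=> n n0 xn; move: (W1 n n0 xn) (W2 n n0 xn); lra.
Qed.

Definition vertical_segment (a b t : R) : set (R * R) :=
  [set p | b <= p.2 <= t] `&` fst @^-1` [set a].

Lemma closed_vertical_segment a b t : closed (vertical_segment a b t).
Proof.
apply: closedI.
  rewrite (_ : mkset _ = snd @^-1` (`[b, t] : set R)); last first.
    by apply/seteqP; split=> q /=; rewrite in_itv.
  have /continuous_closedP := @snd_continuous R R; apply; exact: itv_closed.
have /continuous_closedP := @fst_continuous R R; apply; exact: closed_eq.
Qed.

Lemma vertical_segment_sub n b t : (0 < n)%N -> 0 <= b -> t <= n%:R^-1 ->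
  vertical_segment n%:R^-1 b t `<=` S3 R.
Proof.
move=> n0 b0 tn [x y] [/= /andP[h1 h2] ->]; left; left; exists n => //.
by split => //=; apply/andP; split; lra.
Qed.

Lemma connected_vertical_segment a b t : connected (vertical_segment a b t).
Proof.
apply: connected_convex_fiber => y1 y y2 /= /andP[h1 h2] /andP[h3 h4] /andP[h5 h6].
by apply/andP; split; lra.
Qed.

End Geometry.

Section Subspace.
Context (T : topologicalType) (A : set T).

Lemma closed_set_val (C : set T) : closed C -> closed (set_val @^-1` C : set A).
Proof. by have /continuous_closedP := @initial_continuous A T set_val; apply. Qed.

Lemma connected_set_val (C : set T) : C `<=` A -> connected C ->
  connected (set_val @^-1` C : set A).
Proof.
move=> CA cC B B0 [V [V' oV' VV'] BV] [F clF BF].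
have [F' clF' FF'] : exists2 F' : set T, closed F' & F = set_val @^-1` F'.
  have [G oG GF] := closed_openC clF.
  exists (~` G); first exact: open_closedC.
  by rewrite -[LHS]setCK -GF.
have img G : C `&` G = set_val @` ((set_val @^-1` C : set A) `&` set_val @^-1` G).
  apply/seteqP; split=> [x [Cx Gx]|_ [x [? ?] <-]//].
  by exists (SigSub (mem_set (CA _ Cx))).
have E : C `&` V' = C.
  apply: cC.
  - by have [x Bx] := B0; rewrite img; exists (set_val x), x => //; rewrite VV' -BV.
  - by exists V'.
  - by exists F' => //; rewrite !img VV' -BV -FF' -BF.
by rewrite BV -VV' -preimage_setI E.
Qed.

Lemma compact_set_val : compact A -> compact [set: A].
Proof.
rewrite !compact_near_coveringP => cA I F P FF H.
pose P' i (t : T) := forall x : A, set_val x = t -> P i x.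
have : \near F, A `<=` P' F.
  apply: cA => t At; have := H (SigSub (mem_set At)) Logic.I.
  move=> [[/= V J] [[_ [[W oW <-] Wx] WV] FJ] VJ].
  exists (W, J) => /=.
    by split=> //; apply: open_nbhs_nbhs; split.
  move=> [t' i] /= [Wt' Ji] x xt'.
  by apply: (VJ (x, i)); split=> //=; apply: WV; rewrite /= xt'.
apply: filterS => i H' x _; apply: (H' (set_val x)) => //.
exact: set_valP.
Qed.

End Subspace.

(** * Every ultrafilter order is determined by countably many comparisons *)

Section UpperBound.
Variable R : realType.

Definition S3pt (p : R * R) (h : S3 R p) : S3 R := SigSub (mem_set h).

Lemma S3ptE p (h : S3 R p) : set_val (S3pt h) = p.
Proof. by []. Qed.

Lemma set_valS3 (p : S3 R) : S3 R (set_val p).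
Proof. exact: set_valP. Qed.

Lemma S3_fst_itv (p : S3 R) : 0 <= (set_val p).1 <= 1.
Proof. by have [] := (S3P _).1 (set_valS3 p). Qed.

Lemma S3_snd_itv (p : S3 R) : 0 <= (set_val p).2 <= (set_val p).1.
Proof. by have [] := (S3P _).1 (set_valS3 p). Qed.

Lemma S3_bar n (y : R) : 0 <= y <= n.+1%:R^-1 -> S3 R (n.+1%:R^-1, y).
Proof. by move=> h; left; left; exists n.+1. Qed.

Lemma S3_bot n : S3 R (n.+1%:R^-1, 0).
Proof. by apply: S3_bar; rewrite lexx ltW ?invn_gt0. Qed.

Lemma S3_top n : S3 R (n.+1%:R^-1, n.+1%:R^-1).
Proof. by apply: S3_bar; rewrite lexx ltW ?invn_gt0. Qed.

Definition origin : S3 R := @S3pt (0, 0) (or_intror erefl).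
Definition bot n : S3 R := S3pt (S3_bot n).
Definition top n : S3 R := S3pt (S3_top n).

Lemma S3_eq (p q : S3 R) : (set_val p).1 = (set_val q).1 ->
  (set_val p).2 = (set_val q).2 -> p = q.
Proof.
move=> E1 E2; apply: val_inj; rewrite -!set_valE.
by rewrite [LHS]surjective_pairing [RHS]surjective_pairing E1 E2.
Qed.

Lemma S3_fiber (p q : S3 R) : (set_val p).1 = (set_val q).1 -> p <> q ->
  exists n, (set_val p).1 = n.+1%:R^-1.
Proof.
move=> Ex pq.
have [/andP[x0 x1] /andP[y0 yx] W] := (S3P _).1 (set_valS3 p).
have [_ /andP[y0' yx'] W'] := (S3P _).1 (set_valS3 q).
have pq2 : (set_val p).2 <> (set_val q).2.
  by move=> Ey; apply: pq; exact: S3_eq.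
have xp : 0 < (set_val p).1.
  by rewrite lt_neqAle x0 andbT; apply/eqP => x00; apply: pq2; lra.
have [|[//|n] _] := @invn_bracket _ (set_val p).1; first by rewrite xp.
move=> /andP[nx]; rewrite le_eqVlt => /orP[/eqP xn|xn]; first by exists n.
exfalso; apply: pq2; rewrite (W n.+1) ?nx // (W' n.+1) -?Ex ?nx //.
Qed.

Variable d : S3 R -> S3 R -> R.
Hypothesis hd : generating_metric d.

(** The continua are the slabs to the left and to the right of [q]. *)
Lemma between_fst r p q s : ultrafilter_orders d r ->
  (set_val p).1 < (set_val q).1 < (set_val s).1 ->
  (r p q <-> r q s) /\ (r p q <-> r p s).
Proof.
move=> hr /andP[pq qs].
have /andP[p0 p1] := S3_fst_itv p; have /andP[s0 s1] := S3_fst_itv s.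
have sub a b : slab a b `<=` S3 R by move=> x [].
apply: (ultra_between hd hr (C1 := set_val @^-1` slab 0 (set_val q).1)
  (C2 := set_val @^-1` slab (set_val q).1 1)).
- by apply: closed_set_val; exact: closed_slab.
- by apply: connected_set_val => //; apply: connected_slab => //; lra.
- by apply: closed_set_val; exact: closed_slab.
- by apply: connected_set_val => //; apply: connected_slab => //; lra.
- by split; [exact: set_valS3|rewrite /= p0 ltW].
- by split; [exact: set_valS3|rewrite /= lexx andbT; lra].
- by move=> [_ /= /andP[_]]; rewrite leNgt qs.
- by split; [exact: set_valS3|rewrite /= lexx /=; lra].
- by split; [exact: set_valS3|rewrite /= s1 ltW].
- by move=> [_ /= /andP[+ _]]; rewrite leNgt pq.
Qed.

(** The continua are the subsegments of a bar below and above [q]. *)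
Lemma between_snd r n p q s : ultrafilter_orders d r ->
  (set_val p).1 = n.+1%:R^-1 -> (set_val q).1 = n.+1%:R^-1 ->
  (set_val s).1 = n.+1%:R^-1 ->
  (set_val p).2 < (set_val q).2 < (set_val s).2 ->
  (r p q <-> r q s) /\ (r p q <-> r p s).
Proof.
move=> hr px qx sx /andP[pq qs].
have /andP[p0 _] := S3_snd_itv p; have /andP[_] := S3_snd_itv s; rewrite sx => s1.
apply: (ultra_between hd hr 
  (C1 := set_val @^-1` vertical_segment n.+1%:R^-1 (set_val p).2 (set_val q).2)
  (C2 := set_val @^-1` vertical_segment n.+1%:R^-1 (set_val q).2 (set_val s).2)).
- by apply: closed_set_val; exact: closed_vertical_segment.
- apply: connected_set_val; last exact: connected_vertical_segment.
  by apply: vertical_segment_sub => //; exact: le_trans (ltW qs) s1.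
- by apply: closed_set_val; exact: closed_vertical_segment.
- apply: connected_set_val; last exact: connected_vertical_segment.
  by apply: vertical_segment_sub => //; exact: le_trans p0 (ltW pq).
- by split => //=; rewrite lexx ltW.
- by split => //=; rewrite lexx ltW.
- by move=> [/= /andP[_]]; rewrite leNgt qs.
- by split => //=; rewrite lexx ltW.
- by split => //=; rewrite lexx ltW.
- by move=> [/= /andP[+ _]]; rewrite leNgt pq.
Qed.

(** One comparison decides the direction of the whole order across the bars. *)
Lemma order_fst r p q : ultrafilter_orders d r ->
  (set_val p).1 < (set_val q).1 -> (r p q <-> r origin (bot 0)).
Proof.
move=> hr pq.
have bot01 : (set_val (bot 0)).1 = 1 by rewrite S3ptE /= invr1.
have toO (x y : S3 R) : (set_val x).1 < (set_val y).1 -> (r x y <-> r origin y).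
  move=> xy; have /andP[x0 _] := S3_fst_itv x.
  move: x0; rewrite le_eqVlt => /orP[/eqP x0|x0].
    suff -> : x = origin by [].
    have /andP[] := S3_snd_itv x; rewrite -x0 => y0 y1.
    by apply: S3_eq; rewrite ?S3ptE /= -?x0 //; lra.
  have [] := @between_fst r origin x y hr; first by rewrite /= x0.
  by move=> <- ->.
have toE (y : S3 R) : 0 < (set_val y).1 < 1 -> (r origin y <-> r origin (bot 0)).
  by move=> y01; have [] := @between_fst r origin y (bot 0) hr; rewrite ?bot01.
rewrite toO //; have /andP[p0 _] := S3_fst_itv p; have /andP[_ q1] := S3_fst_itv q.
move: q1; rewrite le_eqVlt => /orP[/eqP q1|q1]; last first.
  by apply: toE; apply/andP; split => //; exact: le_lt_trans p0 pq.
(* The points over 1 are compared through a point over 1/2. *)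
have hb : (set_val (bot 1)).1 = 2^-1 by [].
have h01 : 0 < (2^-1 : R) < 1 by lra.
rewrite -(toE (bot 1)) ?hb //.
by have [|-> ->] := @between_fst r origin (bot 1) q hr; rewrite ?hb ?q1.
Qed.

(** One comparison per bar decides the direction of the order on that bar. *)
Lemma order_snd r n p q : ultrafilter_orders d r ->
  (set_val p).1 = n.+1%:R^-1 -> (set_val q).1 = n.+1%:R^-1 ->
  (set_val p).2 < (set_val q).2 -> (r p q <-> r (bot n) (top n)).
Proof.
move=> hr px qx pq.
have /andP[p0 _] := S3_snd_itv p; have /andP[_] := S3_snd_itv q; rewrite qx => q1.
have -> : r p q <-> r (bot n) q.
  move: p0; rewrite le_eqVlt => /orP[/eqP p0|p0].
    suff -> : p = bot n by [].
    by apply: S3_eq; rewrite ?px -?p0.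
  have [||||] := @between_snd r n (bot n) p q hr => //; first by rewrite /= p0.
  by move=> <- ->.
move: q1; rewrite le_eqVlt => /orP[/eqP q1|q1].
  suff -> : q = top n by [].
  by apply: S3_eq; rewrite ?qx ?q1.
have [||||] := @between_snd r n (bot n) q (top n) hr => //.
by rewrite /= q1 andbT; lra.
Qed.

Lemma order_determined r r' :
  ultrafilter_orders d r -> ultrafilter_orders d r' ->
  (r origin (bot 0) <-> r' origin (bot 0)) ->
  (forall n, r (bot n) (top n) <-> r' (bot n) (top n)) -> r = r'.
Proof.
move=> hr hr' E En; apply/funext => p; apply/funext => q; apply/propext.
have [<-|pq] := pselect (p = q).
  have refl u : ultrafilter_orders d u -> u p p.
    by move=> hu; have [] := ultra_total hu p p.
  by split=> _; exact: refl.
(* For distinct points, totality and antisymmetry turn the comparison of q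
   with p into the negation of that of p with q. *)
have flip u : ultrafilter_orders d u -> (u p q <-> ~ u q p).
  move=> hu; split; last by have [] := ultra_total hu p q.
  move=> upq uqp; apply: pq. exact (ultra_antisym hd hu upq uqp).
have [lt|gt|eqx] := ltgtP (set_val p).1 (set_val q).1.
- by rewrite !order_fst.
- by rewrite (flip r hr) (flip r' hr') !order_fst // E.
have [n px] := S3_fiber eqx pq; have qx := esym eqx; rewrite px in qx.
have [lt|gt|eqy] := ltgtP (set_val p).2 (set_val q).2.
- by rewrite !(@order_snd _ n).
- by rewrite (flip r hr) (flip r' hr') !(@order_snd _ n) // En.
by exfalso; apply: pq; exact: S3_eq.
Qed.

(** The code of an order records the direction across the bars at [0] and the
    direction of the [n]-th bar at [n.+1]. *)
Lemma card_orders_le : (ultrafilter_orders d #<= [set: set nat])%card.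
Proof.
apply/pcard_injP.
exists (fun r => [set k | if k is n.+1 then r (bot n) (top n) else r origin (bot 0)]).
move=> r r'; rewrite !inE => hr hr' E.
have Ek k : [set k | if k is n.+1 then r (bot n) (top n) else r origin (bot 0)] k
  <-> [set k | if k is n.+1 then r' (bot n) (top n) else r' origin (bot 0)] k.
  by rewrite E.
apply: order_determined => //; first exact: (Ek 0%N).
by move=> n; exact: (Ek n.+1).
Qed.

End UpperBound.

(** * Chains pulled back from the line *)

Section PulledBackChains.
Context (R : realType) (X : topologicalType) (d : X -> X -> R).
Hypothesis hd : generating_metric d.

Lemma near_metric_lt (e : R) (z : X * X) : d z.1 z.2 < e ->
  \forall z' \near z, d z'.1 z'.2 < e.
Proof.
have [_ _ dC dT nb] := hd; case: z => x y /= dxy.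
have ball t : nbhs t [set t' | d t t' < (e - d x y) / 2].
  by rewrite nb; exists ((e - d x y) / 2) => //=; rewrite divr_gt0 // subr_gt0.
exists ([set t' | d x t' < (e - d x y) / 2], [set t' | d y t' < (e - d x y) / 2]).
  by split; exact: ball.
move=> [x' y'] [/= dx dy].
have := dT x' x y'; have := dT x y y'; have := dC x x'; lra.
Qed.

(** The pairs at distance at least [e] form a compact set on which the
    continuous function [F] does not vanish. *)
Lemma close_of_small_value (F : X * X -> R) (e : R) :
  compact [set: X] -> continuous F -> (forall x y, F (x, y) = 0 -> d x y < e) ->
  exists2 c : R, 0 < c & forall x y, `|F (x, y)| < c -> d x y < e.
Proof.
move=> cX cF F0.
have : compact [set: X * X] by rewrite -setXTT; exact: compact_setX.
move=> /compact_near_coveringP /(_ R (0^'+)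
  (fun c z => `|F z| < c -> d z.1 z.2 < e)) [].
  move=> z _; have [Fz|Fz] := eqVneq (F z) 0.
    have : d z.1 z.2 < e by apply: F0; rewrite -surjective_pairing.
    move=> /near_metric_lt H; exists ([set z' | d z'.1 z'.2 < e], setT).
      by split => //=; exact: filterT.
    by move=> [z' c] [].
  have c0 : 0 < `|F z| / 2 by rewrite divr_gt0 // normr_gt0.
  exists ([set z' | `|F z| / 2 < `|F z'|], [set c | c < `|F z| / 2]).
    split => /=; last exact: nbhs_right_lt.
    have cF' : (fun z' => `|F z'|) @ z --> `|F z| by apply: cvg_norm; exact: cF.
    apply: (cF' [set t | `|F z| / 2 < t]); apply: open_nbhs_nbhs.
    by split; [exact: open_gt|rewrite /=; lra].
  move=> [z' c] [/= h1 h2] h3.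
  by have := lt_trans h1 (lt_trans h3 h2); rewrite ltxx.
move=> c /= c0 H; exists (c / 2); first by rewrite divr_gt0.
move=> x y Fxy; apply: (H (c / 2) _ _ (x, y)) => //=; last by rewrite divr_gt0.
by rewrite sub0r normrN gtr0_norm ?divr_gt0 //; lra.
Qed.

Hypothesis connX : connected [set: X].

(** The links are the preimages of the open intervals of radius [w] centred at
    the points of a subdivision of [[g p0, g p1]] of step [w]. *)
Lemma pullback_chain (g : X -> R) (p0 p1 : X) (e c : R) :
  continuous g -> (forall x, g p0 <= g x <= g p1) -> g p0 < g p1 -> 0 <= e ->
  0 < c -> (forall x y, `|g x - g y| < c -> d x y <= e) ->
  exists s : seq (set X), [/\ is_chain s, covers s, (mesh d s <= e%:E)%E,
    forall x y, g x <= g y -> chain_le s x y &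
    forall x y, chain_le s x y -> g x < g y + c].
Proof.
move=> cg g01 lt01 e0 c0 gd.
pose m := (Num.truncn (2 * (g p1 - g p0) / c)).+1.
have m0 : 0 < m%:R :> R by rewrite ltr0n.
pose w := (g p1 - g p0) / m%:R.
have w0 : 0 < w by rewrite divr_gt0 // subr_gt0.
have mw : m%:R * w = g p1 - g p0 by rewrite /w mulrC divfK // gt_eqF.
have w2c : 2 * w < c.
  have : 2 * (g p1 - g p0) / c < m%:R by exact: truncnS_gt.
  rewrite ltr_pdivrMr // -mw mulrCA.
  by rewrite ltr_pM2l.
pose link i : set X := [set x | `|g x - (g p0 + i%:R * w)| < w].
pose s := mkseq link m.+1.
have ss : size s = m.+1 by rewrite size_mkseq.
have sE i : (i < m.+1)%N -> nth set0 s i = link i by move=> im; rewrite nth_mkseq.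
have linkP i x : link i x <-> - w < g x - (g p0 + i%:R * w) < w.
  by rewrite /link /= ltr_norml.
have linkI i j x : link i x -> link j x -> (i < j.+2)%N.
  move=> /linkP/andP[h1 _] /linkP/andP[_ h2].
  rewrite -(ltr_nat R) -addn2 natrD -(ltr_pM2r w0) mulrDl; lra.
have attain (t : R) : g p0 <= t <= g p1 -> exists x, g x = t.
  move=> t01; have : connected (g @` setT).
    by apply: connected_continuous_connected => //; exact: continuous_subspaceT.
  move=> /connected_intervalP /(_ (g p0) (g p1)).
  by move=> /(_ _ _ t t01) [||x _ <-]; [exists p0|exists p1|exists x].
pose idx x := Num.truncn ((g x - g p0) / w).
have idxP x : (idx x <= m)%N /\ link (idx x) x.
  have /andP[gx0 gx1] := g01 x.
  have /truncn_itv/andP[] : 0 <= (g x - g p0) / w by rewrite divr_ge0 ?subr_ge0 // ltW.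
  rewrite -/(idx x) ler_pdivlMr // ltr_pdivrMr // -natr1 mulrDl mul1r => h1 h2.
  split; last by apply/linkP; lra.
  rewrite -(ler_nat R) -(ler_pM2r w0) mw; lra.
exists s; split.
- split=> [i|i j]; rewrite ss.
    move=> im; rewrite sE //.
    rewrite (_ : link i = (fun x => `|g x - (g p0 + i%:R * w)|) @^-1` [set t | t < w]) //.
    apply: open_comp; last exact: open_lt.
    move=> x _; apply: cvg_norm; apply: cvgB; [exact: cg|exact: cvg_cst].
  move=> im jm; rewrite !sE //; split.
    move=> [x [ix jx]]; have := linkI i j x ix jx; have := linkI j i x jx ix; lia.
  have im' : i%:R <= m%:R :> R by rewrite ler_nat.
  have jm' : j%:R <= m%:R :> R by rewrite ler_nat.
  move=> ij; have [|x gx] := attain (g p0 + (i%:R + j%:R) / 2 * w).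
    apply/andP; split.
      by rewrite lerDl; apply: mulr_ge0; [rewrite divr_ge0 ?addr_ge0|exact: ltW].
    rewrite -lerBrDl -mw ler_pM2r //; lra.
  have ij1 : i%:R <= j%:R + 1 :> R by rewrite natr1 ler_nat; lia.
  have ji1 : j%:R <= i%:R + 1 :> R by rewrite natr1 ler_nat; lia.
  have ijw : i%:R * w <= j%:R * w + w.
    by rewrite -[X in _ + X]mul1r -mulrDl ler_pM2r.
  have jiw : j%:R * w <= i%:R * w + w.
    by rewrite -[X in _ + X]mul1r -mulrDl ler_pM2r.
  by exists x; split; apply/linkP; rewrite gx; lra.
- by move=> x; have [im ix] := idxP x; exists (idx x); rewrite ?ss ?sE.
- rewrite /mesh big_seq; apply: bigmax_le; first by rewrite lee_fin.
  move=> u /(nthP set0)[i]; rewrite ss => im <-; rewrite sE //.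
  apply: ge_ereal_sup => _ [x /linkP ix [y /linkP iy <-]]; rewrite lee_fin.
  by apply: gd; rewrite ltr_norml; lra.
- move=> x y gxy; have [im ix] := idxP x; have [jm jy] := idxP y.
  exists (idx x), (idx y); rewrite ss !sE //; split => //.
  by apply: le_truncn; rewrite ler_pM2r ?invr_gt0 //; lra.
- move=> x y [i [j []]]; rewrite ss => ij jm; rewrite !sE //; last exact: leq_ltn_trans jm.
  move=> /linkP ix /linkP jy.
  have : i%:R * w <= j%:R * w by rewrite ler_pM2r // ler_nat.
  lra.
Qed.

End PulledBackChains.

(** * Functions that run through each bar in a chosen direction *)

Section Ladders.
Variable R : realType.
Implicit Types (p q : R * R) (n : nat) (u : bool).

(** As [x] approaches the left end of its interval, [1 / phase n x] takes all
    large values. *)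
Lemma wave_hits_near_left_end n (e : R) u : (0 < n)%N -> 0 < e ->
  exists x, [/\ n.+1%:R^-1 < x < n%:R^-1, x < n.+1%:R^-1 + e & wave n x = u%:R].
Proof.
move=> n0 e0; set l : R := n.+1%:R^-1; set r : R := n%:R^-1.
have lr : l < r by rewrite /l /r invn_ltE.
pose x1 := l + Num.min e (r - l) / 2.
have mn0 : 0 < Num.min e (r - l) by rewrite lt_min e0 subr_gt0.
have mne : Num.min e (r - l) <= e by rewrite ge_min lexx.
have mnr : Num.min e (r - l) <= r - l by rewrite ge_min lexx orbT.
have lx1 : l < x1 by rewrite /x1; lra.
have x1r : x1 < r by rewrite /x1; lra.
have x1e : x1 < l + e by rewrite /x1; lra.
have ph1 : 0 < phase n x1 by apply: phase_gt0; apply/andP.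
pose th : R := if u then pi / 2 else 0.
have th0 : 0 <= th by rewrite /th; case: (u) => //; have := @pi_ge2 R; lra.
pose k := (Num.truncn (1 / phase n x1)).+1.
pose t := th + pi *+ k.
have tph : 1 / phase n x1 < t.
  have : 1 / phase n x1 < k%:R by exact: truncnS_gt.
  have : 1 * k%:R <= pi * k%:R :> R.
    by rewrite ler_wpM2r ?ler0n //; have := @pi_ge2 R; lra.
  by rewrite mulr_natr mul1r /t; lra.
have t0 : 0 < t by apply: lt_trans tph; rewrite divr_gt0.
have tV : t^-1 <= phase n x1.
  by rewrite -[leRHS]invrK lef_pV2 ?posrE ?invr_gt0 //; move: tph; rewrite div1r => /ltW.
have phl : phase n l = 0 by rewrite /phase subrr mul0r.
have [|||x] := @IVT R (phase n) l x1 t^-1.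
- exact: ltW.
- by apply: continuous_subspaceT; exact: phase_continuous.
- by rewrite phl (min_l (ltW ph1)) (max_r (ltW ph1)) tV invr_ge0 ltW.
rewrite in_itv /= => /andP[lx xx1] px.
have lx' : l < x.
  rewrite lt_neqAle lx andbT; apply/eqP => lx0; move: px; rewrite -lx0 phl.
  by move=> /esym/eqP; rewrite invr_eq0 gt_eqF.
exists x; split; [by apply/andP; lra|lra|].
rewrite /wave px div1r invrK /t (alternatingn (@sinDpi R)) normrM normrX normrN1.
rewrite expr1n mul1r /th; case: (u) => /=; first by rewrite sin_pihalf normr1.
by rewrite sin0 normr0.
Qed.

Lemma wave_hits_near_right_end n (e : R) u : (0 < n)%N -> 0 < e ->
  exists x, [/\ n.+1%:R^-1 < x < n%:R^-1, n%:R^-1 - e < x & wave n x = u%:R].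
Proof.
move=> n0 e0; have [x [/andP[x1 x2] x3 wx]] := wave_hits_near_left_end u n0 e0.
exists (n.+1%:R^-1 + n%:R^-1 - x); split; last first.
- rewrite -wx /wave; suff -> : phase n (n.+1%:R^-1 + n%:R^-1 - x) = phase n x by [].
  by rewrite /phase mulrC; congr *%R; ring.
- by move: (n.+1%:R^-1) (n%:R^-1) x3 => l r; lra.
- by move: (n.+1%:R^-1) (n%:R^-1) x1 x2 => l r *; apply/andP; lra.
Qed.

(** Separators of the slabs: [mid n] lies between the [n]-th and the next unit
    fraction. *)
Definition mid n : R := 2 / (2 * n%:R + 1).

Lemma mid_le m n : (m <= n)%N -> mid n <= mid m.
Proof.
move=> mn; rewrite /mid ler_pM2l // lef_pV2 ?posrE; last 2 first.
- by rewrite ltr_wpDl // mulr_ge0.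
- by rewrite ltr_wpDl // mulr_ge0.
by rewrite lerD2r ler_pM2l // ler_nat.
Qed.

Lemma mid_gt0 n : 0 < mid n.
Proof. by rewrite /mid divr_gt0 // ltr_wpDl // mulr_ge0. Qed.

Lemma invn_lt_mid n : (n.+1%:R^-1 : R) < mid n.
Proof.
have n0 : 0 <= n%:R :> R by [].
rewrite /mid ltr_pdivlMr; last lra.
by rewrite mulrC ltr_pdivrMr ?ltr0n // -natr1; lra.
Qed.

Lemma mid_lt_invn n : mid n.+1 < (n.+1%:R^-1 : R).
Proof.
have n0 : 0 < n.+1%:R :> R by rewrite ltr0n.
rewrite /mid ltr_pdivrMr; last lra.
by rewrite mulrDr mulrCA mulVf ?gt_eqF // !mulr1 ltrDl invr_gt0.
Qed.

Lemma left_face (e : R) u n : 0 < e ->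
  exists a, [/\ n.+1%:R^-1 - e < a, mid n.+1 < a < n.+1%:R^-1 &
    forall y, S3 R (a, y) -> y = u%:R * a].
Proof.
move=> e0; have := mid_lt_invn n; set c : R := n.+1%:R^-1 => mc.
pose e' := Num.min e (c - mid n.+1).
have e'0 : 0 < e' by rewrite lt_min e0 subr_gt0.
have e'e : e' <= e by rewrite ge_min lexx.
have e'm : e' <= c - mid n.+1 by rewrite ge_min lexx orbT.
have [a [/andP[a1 a2] a3 wa]] := wave_hits_near_right_end u (ltn0Sn n) e'0.
exists a; rewrite -/c in a2 a3; split; [lra|by apply/andP; lra|].
by move=> y /S3P[_ _ /(_ n.+1)] /= -> //; rewrite ?wa 1?mulrC // a1.
Qed.

Lemma right_face (e : R) u n : 0 < e ->
  exists b, [/\ b < n.+1%:R^-1 + e, n.+1%:R^-1 < b < mid n &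
    forall y, S3 R (b, y) -> y = u%:R * b].
Proof.
move=> e0; have := invn_lt_mid n; set c : R := n.+1%:R^-1 => cm.
pose e' := Num.min e (mid n - c).
have e'0 : 0 < e' by rewrite lt_min e0 subr_gt0.
have e'e : e' <= e by rewrite ge_min lexx.
have e'm : e' <= mid n - c by rewrite ge_min lexx orbT.
have [n0|n0] := posnP n.
  (* To the right of the bar over 1 there are no points at all. *)
  have c1 : c = 1 by rewrite /c n0 invr1.
  exists (c + e' / 2); split; [lra|by apply/andP; lra|move=> y].
  by move=> /S3P[/= /andP[_]]; lra.
have [b [/andP[b1 b2] b3 wb]] := wave_hits_near_left_end u n0 e'0.
exists b; rewrite -/c in b1 b3; split; [lra|by apply/andP; lra|].
by move=> y /S3P[_ _ /(_ n)] /= -> //; rewrite ?wb 1?mulrC // b1.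
Qed.

(** A slab around the bar over [n.+1%:R^-1] whose two faces meet the continuum in
    at most one point each, one on the axis and the other one on the diagonal,
    in the order given by [u]. *)
Definition good_slab (e : R) u n (a b : R) : Prop :=
  [/\ n.+1%:R^-1 - e < a, mid n.+1 < a < n.+1%:R^-1,
      n.+1%:R^-1 < b < mid n, b < n.+1%:R^-1 + e &
      forall y, (S3 R (a, y) -> y = (~~ u)%:R * a) /\ (S3 R (b, y) -> y = u%:R * b)].

Lemma good_slab_exists (e : R) u n : 0 < e ->
  exists ab : R * R, good_slab e u n ab.1 ab.2.
Proof.
move=> e0; have [a [a1 a2 aP]] := left_face (~~ u) n e0.
have [b [b1 b2 bP]] := right_face u n e0.
by exists (a, b); split => // y; split; [exact: aP|exact: bP].
Qed.

(** On the slab, the relative height [p.2 / p.1], read upwards or downwards. *)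
Definition height u p : R := if u then p.2 / p.1 else 1 - p.2 / p.1.

Definition step u (a b : R) p : R :=
  if p.1 <= a then 0 else if b <= p.1 then 1 else height u p.

Lemma S3_ratio p : S3 R p -> 0 <= p.2 / p.1 <= 1.
Proof.
move=> /S3P[/andP[x0 _] /andP[y0 yx] _]; rewrite divr_ge0 //=.
move: x0; rewrite le_eqVlt => /orP[/eqP <-|x0]; first by rewrite invr0 mulr0.
by rewrite ler_pdivrMr // mul1r.
Qed.

Lemma step_itv u a b p : S3 R p -> 0 <= step u a b p <= 1.
Proof.
move=> /S3_ratio/andP[h1 h2]; rewrite /step /height.
by case: ifP => _; [|case: ifP => _; [|case: u]]; apply/andP; split; lra.
Qed.

(** The three pieces of the definition agree where they meet: this is what
    the faces of a good slab are for. *)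
Lemma step_continuous (e : R) u n a b : good_slab e u n a b ->
  {within S3 R, continuous (step u a b)}.
Proof.
move=> [_ /andP[ma ac] /andP[cb bm] _ Wab].
have c0 : 0 < n.+1%:R^-1 :> R by exact: invn_gt0.
have a0 : 0 < a.
  exact: lt_trans (mid_gt0 _) ma.
have ab : a < b by exact: lt_trans ac cb.
rewrite (_ : S3 R = (slab 0 a `|` slab a b) `|` slab b 1); last first.
  apply/seteqP; split=> p; last by case=> [[]|] [].
  move=> Sp; have [/= /andP[x0 x1] _ _] := (S3P _).1 Sp.
  have [pa|ap] := leP p.1 a; first by left; left; split; rewrite /= ?x0.
  have [pb|bp] := leP p.1 b; first by left; right; split; rewrite /= ?pb ?ltW.
  by right; split; rewrite //= x1 ltW.
apply: withinU_continuous; first by apply: closedU; exact: closed_slab.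
- exact: closed_slab.
- apply: withinU_continuous; [exact: closed_slab|exact: closed_slab| |].
    apply: (@subspace_eq_continuous _ _ _ (fun=> 0)); last exact: cst_continuous.
    by move=> p; rewrite inE => -[_ /= /andP[_ pa]]; rewrite /from_subspace /step ifT.
  apply: (@subspace_eq_continuous _ _ _ (height u)).
    move=> [x y]; rewrite inE => -[Sp /= /andP[ax xb]]; rewrite /from_subspace /step /=.
    case: ifP => xa.
      have xaE : x = a by apply/eqP; rewrite eq_le xa ax.
      move: Sp; rewrite /height xaE /= => /(Wab y).1 ->.
      by rewrite mulfK ?gt_eqF //; case: (u) => /=; lra.
    case: ifP => // bx.
    have xbE : x = b by apply/eqP; rewrite eq_le xb bx.
    move: Sp; rewrite /height xbE /= => /(Wab y).2 ->.
    by rewrite mulfK ?gt_eqF ?(lt_trans a0 ab) //; case: (u) => /=; lra.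
  apply/subspace_continuousP => p [_ /= /andP[ap _]].
  apply: cvg_within_filter.
  have cr : q.2 / q.1 @[q --> p] --> p.2 / p.1.
    apply: cvgM; first exact: snd_continuous.
    apply: cvgV; last exact: fst_continuous.
    by rewrite gt_eqF // (lt_le_trans a0).
  rewrite /height; case: (u) => //.
  by apply: cvgB; [exact: cvg_cst|exact: cr].
- apply: (@subspace_eq_continuous _ _ _ (fun=> 1 : R)); last exact: cst_continuous.
  move=> p; rewrite inE => -[_ /= /andP[bp _]]; rewrite /from_subspace /step ifF ?ifT //.
  by apply/negbTE; rewrite -ltNge (lt_le_trans ab bp).
Qed.

End Ladders.

Section Ladder.
Variables (R : realType) (e : R) (u : nat -> bool) (a b : nat -> R).
Hypothesis good : forall n, good_slab e (u n) n (a n) (b n).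
Implicit Types (p q : R * R) (n k N : nat).

(** One step across each of the first [N] bars, plus a slope which separates
    points with different first coordinates. *)
Definition ladder N p : R := p.1 + \sum_(i < N) step (u i) (a i) (b i) p.

Lemma slab_lt n : a n < b n.
Proof. by have [_ /andP[_ h1] /andP[h2 _] _ _] := good n; exact: lt_trans h1 h2. Qed.

Lemma slab_gt0 n : 0 < a n.
Proof. by have [_ /andP[h _] _ _ _] := good n; exact: lt_trans (mid_gt0 _ _) h. Qed.

Lemma slab_disjoint n k : (k < n)%N -> b n < a k.
Proof.
move=> kn; have [_ _ /andP[_ h1] _ _] := good n.
have [_ /andP[h2 _] _ _ _] := good k.
exact: lt_trans h1 (le_lt_trans (mid_le R kn) h2).
Qed.

Lemma step_other n k p q : k != n -> a n <= p.1 <= b n -> a n <= q.1 <= b n ->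
  step (u k) (a k) (b k) p = step (u k) (a k) (b k) q.
Proof.
rewrite neq_ltn => /orP[kn|nk] /andP[p1 p2] /andP[q1 q2]; rewrite /step.
  by rewrite !ifT // ltW // (le_lt_trans _ (slab_disjoint kn)).
have bx x : a n <= x -> b k <= x by move/(lt_le_trans (slab_disjoint nk))/ltW.
have xa x : a n <= x -> (x <= a k) = false.
  by move=> h; apply/negbTE; rewrite -ltNge (lt_le_trans (slab_lt k)) // bx.
by rewrite !xa // !bx.
Qed.

Lemma step_inner n p : a n < p.1 < b n ->
  step (u n) (a n) (b n) p = height (u n) p.
Proof. by move=> /andP[h1 h2]; rewrite /step leNgt h1 /= leNgt h2. Qed.

Lemma ladder_inner N n p q : (n < N)%N -> a n < p.1 < b n -> a n < q.1 < b n ->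
  ladder N p - ladder N q = p.1 - q.1 + (height (u n) p - height (u n) q).
Proof.
move=> nN pn qn; pose rest q := \sum_(i < N | i != Ordinal nN) step (u i) (a i) (b i) q.
have E q' : ladder N q' = q'.1 + (step (u n) (a n) (b n) q' + rest q').
  by rewrite /ladder (bigD1 (Ordinal nN)).
rewrite !E !step_inner //.
have /andP[/ltW p1 /ltW p2] := pn; have /andP[/ltW q1 /ltW q2] := qn.
have -> : rest p = rest q.
  apply: eq_bigr => i ni; apply: (@step_other n); try exact/andP.
  by apply: contraNN ni => /eqP E'; apply/eqP/val_inj.
by lra.
Qed.

Lemma bar_inner n : a n < (n.+1%:R^-1 : R) < b n.
Proof. by have [_ /andP[_ ->] /andP[-> _] _ _] := good n. Qed.

Lemma ladder_bar N n : (n < N)%N ->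
  ladder N (n.+1%:R^-1, n.+1%:R^-1) - ladder N (n.+1%:R^-1, 0) =
  if u n then 1 else -1.
Proof.
move=> nN; rewrite (ladder_inner nN) ?bar_inner // subrr add0r /height /=.
rewrite mul0r divff ?invr_eq0 ?pnatr_eq0 //.
by case: (u n); lra.
Qed.

(** Outside of the slabs the ladder is increasing in the first coordinate, and
    two points of one slab at the same level have almost the same height. *)
Lemma ladder_fiber N (c : R) p q : N.+1%:R^-1 < c -> 6 * e <= c ->
  S3 R p -> S3 R q -> ladder N p = ladder N q ->
  `|p.1 - q.1| + `|p.2 - q.2| < c.
Proof.
move=> Nc ec; wlog pq : p q / p.1 <= q.1.
  move=> W Sp Sq E; have [pq|/ltW qp] := leP p.1 q.1; first exact: W.
  by rewrite distrC [X in _ + X]distrC; exact: W.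
move=> Sp Sq E.
have [[n nN /andP[ap qb]]|none] :=
    pselect (exists2 n, (n < N)%N & (a n < p.1) && (q.1 < b n)).
  have [h1 _ _ h2 _] := good n.
  have D : q.1 - p.1 < 2 * e by move: (n.+1%:R^-1) h1 h2 => x; lra.
  have := @ladder_inner N n p q nN; rewrite E subrr ap qb (lt_le_trans ap pq).
  rewrite (le_lt_trans pq qb) => /(_ isT isT) H.
  have p0 := lt_trans (slab_gt0 n) ap; have q0 := lt_le_trans p0 pq.
  have /andP[vp0 vp1] := S3_ratio Sp; have /andP[vq0 vq1] := S3_ratio Sq.
  have py : p.2 = p.2 / p.1 * p.1 by rewrite divfK // gt_eqF.
  have qy : q.2 = q.2 / q.1 * q.1 by rewrite divfK // gt_eqF.
  have [/andP[_ qx1] _ _] := (S3P q).1 Sq.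
  have Dv : `|p.2 / p.1 - q.2 / q.1| <= q.1 - p.1.
    by rewrite ler_norml; apply/andP; move: H; rewrite /height; case: (u n); lra.
  have Dy : `|p.2 - q.2| <= 2 * (q.1 - p.1).
    rewrite py qy; move: Dv vp0 vp1; set vp := p.2 / p.1; set vq := q.2 / q.1.
    move=> Dv vp0 vp1.
    have -> : vp * p.1 - vq * q.1 = (vp - vq) * q.1 - vp * (q.1 - p.1) by ring.
    apply: le_trans (ler_normB _ _) _; rewrite mulr_natl mulr2n; apply: lerD.
      rewrite normrM (gtr0_norm q0); apply: le_trans Dv.
      by rewrite ler_piMr.
    have D0 : 0 <= q.1 - p.1 by rewrite subr_ge0.
    by rewrite ger0_norm; [exact: ler_piMl|exact: mulr_ge0].
  have Dx : `|p.1 - q.1| = q.1 - p.1 by rewrite distrC ger0_norm // subr_ge0.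
  lra.
have mono (i : 'I_N) : step (u i) (a i) (b i) p <= step (u i) (a i) (b i) q.
  have /andP[p0 p1] := step_itv (u i) (a i) (b i) Sp.
  have /andP[q0 q1] := step_itv (u i) (a i) (b i) Sq.
  have [pa|ap] := leP p.1 (a i); first by rewrite {1}/step pa.
  have [bq|qb] := leP (b i) q.1.
    rewrite {2}/step bq ifF //; apply/negbTE.
    by rewrite -ltNge (lt_le_trans (slab_lt i) bq).
  by exfalso; apply: none; exists i => //; rewrite ap qb.
have Ex : p.1 = q.1.
  apply/eqP; rewrite eq_le pq /=; move: E; rewrite /ladder => E.
  have : \sum_(i < N) step (u i) (a i) (b i) p <=
      \sum_(i < N) step (u i) (a i) (b i) q by apply: ler_sum.
  lra.
rewrite Ex subrr normr0 add0r.
have [pq2|pq2] := pselect (p.2 = q.2).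
  by rewrite pq2 subrr normr0; apply: lt_trans Nc; exact: invn_gt0.
have [m xm] : exists m, q.1 = m.+1%:R^-1.
  have [] := @S3_fiber R (S3pt Sp) (S3pt Sq); rewrite ?S3ptE //.
    by move=> /(congr1 (fun x => (set_val x).2)).
  by move=> m; rewrite Ex => xm; exists m.
have Nm : (N <= m)%N.
  rewrite leqNgt; apply/negP => mN; apply: none; exists m => //.
  by rewrite Ex xm bar_inner.
have [_ /andP[y0 y1] _] := (S3P p).1 Sp; have [_ /andP[y0' y1'] _] := (S3P q).1 Sq.
have : q.1 < c by rewrite xm; apply: le_lt_trans Nc; exact: invn_le.
by rewrite Ex in y1; rewrite ltr_norml; move=> ?; apply/andP; lra.
Qed.

Lemma ladder_continuous N : continuous (fun p : S3 R => ladder N (set_val p)).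
Proof.
elim: N => [|N IH].
  under eq_fun do rewrite /ladder big_ord0 addr0.
  move=> p; apply: (continuous_comp (@initial_continuous _ _ set_val p)).
  exact: fst_continuous.
have -> : (fun x : S3 R => ladder N.+1 (set_val x)) =
    (fun x : S3 R => ladder N (set_val x) + step (u N) (a N) (b N) (set_val x)).
  by apply/funext => x; rewrite /ladder big_ord_recr addrA.
have sc := (subspace_sigL_continuousP _ _).1 (step_continuous (good N)).
by move=> x; exact: cvgD (IH x) (sc x).
Qed.

Lemma ladder_ge_fst N p : S3 R p -> p.1 <= ladder N p.
Proof.
move=> Sp; rewrite /ladder lerDl; apply: sumr_ge0 => i _.
by have /andP[] := step_itv (u i) (a i) (b i) Sp.
Qed.

Lemma ladder_min N p : S3 R p -> ladder N (0, 0) <= ladder N p.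
Proof.
move=> Sp; rewrite /ladder; apply: lerD; first by have [/andP[]] := (S3P p).1 Sp.
apply: ler_sum => i _; have /andP[h _] := step_itv (u i) (a i) (b i) Sp.
by rewrite {1}/step /= ifT // ltW // slab_gt0.
Qed.

Lemma ladder_max N p : S3 R p -> ladder N p <= ladder N (1, (u 0)%:R).
Proof.
move=> Sp; rewrite /ladder; apply: lerD; first by have [/andP[]] := (S3P p).1 Sp.
apply: ler_sum => i _; have /andP[_ h] := step_itv (u i) (a i) (b i) Sp.
apply: le_trans h _; case: i => -[|i] /= _.
  rewrite step_inner; last by have := bar_inner 0; rewrite invr1.
  by rewrite /height /= divr1; case: (u 0) => /=; lra.
have : b i.+1 < 1.
  have [_ _ /andP[_ h] _ _] := good i.+1; apply: lt_le_trans h _.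
  apply: le_trans (mid_le R (ltn0Sn i)) _.
  by rewrite /mid ler_pdivrMr; lra.
have := slab_lt i.+1; rewrite /step /= => h1 h2.
by rewrite ifF ?ifT ?(ltW h2) //; apply/negbTE; rewrite -ltNge (lt_trans h1).
Qed.

End Ladder.

(** * Prescribing the direction of every bar *)

Section LowerBound.
Variables (R : realType) (d : S3 R -> S3 R -> R).
Hypothesis hd : generating_metric d.

Lemma compact_S3T : compact [set: S3 R].
Proof. by apply: compact_set_val; exact: compact_S3. Qed.

Lemma connected_S3T : connected [set: S3 R].
Proof.
have -> : [set: S3 R] = set_val @^-1` slab 0 1.
  apply/seteqP; split => // p _; split; first exact: set_valS3.
  by have [] := (S3P _).1 (set_valS3 p).
by apply: connected_set_val; [move=> ? []|exact: connected_slab].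
Qed.

(** The ladder has small fibers, hence short intervals of the line pull back to
    sets of small diameter; along the resulting chain, each of the first [M]
    bars is run through from one end to the other. *)
Lemma chain_with_bars (B : nat -> bool) M (e : R) : 0 < e ->
  exists s : seq (set (S3 R)), [/\ is_chain s, covers s, (mesh d s <= e%:E)%E &
    forall n, (n < M)%N -> (chain_le s (bot R n) (top R n) <-> B n)].
Proof.
move=> e0; have [_ d0 _ _ _] := hd.
pose F (z : S3 R * S3 R) :=
  `|(set_val z.1).1 - (set_val z.2).1| + `|(set_val z.1).2 - (set_val z.2).2|.
have cval : continuous (set_val : S3 R -> R * R) by exact: initial_continuous.
have [c c0 cF] : exists2 c : R, 0 < c &
    forall x y, `|F (x, y)| < c -> d x y < e.
  apply: close_of_small_value => //; first exact: compact_S3T.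
    move=> z.
    have c1 : (set_val w.1 : R * R) @[w --> z] --> (set_val z.1 : R * R).
      exact: (cvg_comp _ _ (@fst_continuous _ _ z) (cval z.1)).
    have c2 : (set_val w.2 : R * R) @[w --> z] --> (set_val z.2 : R * R).
      exact: (cvg_comp _ _ (@snd_continuous _ _ z) (cval z.2)).
    apply: cvgD; apply: cvg_norm; apply: cvgB.
    - exact: (cvg_comp _ _ c1 (@fst_continuous _ _ _)).
    - exact: (cvg_comp _ _ c2 (@fst_continuous _ _ _)).
    - exact: (cvg_comp _ _ c1 (@snd_continuous _ _ _)).
    - exact: (cvg_comp _ _ c2 (@snd_continuous _ _ _)).
  move=> x y /eqP; rewrite /F paddr_eq0 // !normr_eq0 !subr_eq0.
  by move=> /= /andP[/eqP E1 /eqP E2]; rewrite (S3_eq E1 E2) (d0 y y).2.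
have c6 : 0 < c / 6 by lra.
have [ab abP] := choice (fun n => good_slab_exists (B n) n c6).
have good n : good_slab (c / 6) (B n) n (ab n).1 (ab n).2 by exact: abP.
(* At least [M] bars must be crossed; those that are not crossed, which the
   ladder collapses, must be shorter than [c]. *)
pose N := (Num.truncn c^-1 + M).+1.
have Nc : N.+1%:R^-1 < c.
  rewrite -[ltRHS]invrK ltf_pV2 ?posrE ?invr_gt0 //.
  apply: lt_le_trans (truncnS_gt _) _; rewrite ler_nat /N.
  by rewrite !ltnS (leq_trans (leq_addr M _)).
pose g (p : S3 R) := ladder B (fun n => (ab n).1) (fun n => (ab n).2) N (set_val p).
have cg : continuous g by exact: (ladder_continuous good).
have [c' c'0 c'P] : exists2 c' : R, 0 < c' &
    forall x y, `|g x - g y| < c' -> d x y < e.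
  apply: (@close_of_small_value _ _ _ hd (fun z => g z.1 - g z.2)).
  - exact: compact_S3T.
  - move=> z; apply: cvgB.
      exact: (cvg_comp _ _ (@fst_continuous _ _ z) (cg z.1)).
    exact: (cvg_comp _ _ (@snd_continuous _ _ z) (cg z.2)).
  - move=> x y /eqP; rewrite subr_eq0 => /eqP gxy; apply: cF.
    rewrite ger0_norm ?addr_ge0 //.
    by apply: (ladder_fiber good Nc _ (set_valS3 x) (set_valS3 y) gxy); lra.
have S1 : S3 R (1, (B 0)%:R).
  left; left; exists 1%N => //; split => /=; rewrite invr1 //.
  by case: (B 0); rewrite ?lexx ler01.
have [|||||s [chs cos ms le1 le2]] := @pullback_chain R _ d connected_S3T g (origin R) (S3pt S1) e
    (Num.min c' 1) cg.
- move=> p; apply/andP; split; first exact: (ladder_min good N (set_valS3 p)).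
  exact: (ladder_max good N (set_valS3 p)).
- have g1 : 1 <= g (S3pt S1).
    by rewrite /g S3ptE; exact: ladder_ge_fst _ _ _ _ S1.
  apply: lt_le_trans g1; apply: (@le_lt_trans _ _ 0) => //.
  rewrite /g /ladder big1 /= ?addr0 // => i _.
  by rewrite /step /= ifT // ltW // (slab_gt0 good).
- exact: ltW.
- by rewrite lt_min c'0 ltr01.
- by move=> x y; rewrite lt_min => /andP[h _]; apply: ltW; exact: c'P.
exists s; split => // n nM.
have nN : (n < N)%N by rewrite ltnS (leq_trans (ltnW nM)) // leq_addl.
have := ladder_bar good nN; rewrite -/(g (bot R n)) -/(g (top R n)).
have : Num.min c' 1 <= 1 by rewrite ge_min lexx orbT.
case: (B n) => h1 h2; split => //.
  by move=> _; apply: le1; lra.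
by move=> /le2 h3; exfalso; lra.
Qed.

Lemma nonprincipal_ultrafilter : exists U : set_system nat,
  [/\ UltraFilter U, forall n, U <> principal_filter n &
      forall m, U [set n | (m <= n)%N]].
Proof.
have [U [UU sU]] := ultraFilterLemma (eventually_filter).
have Um m : U [set n | (m <= n)%N] by apply: sU; exists m.
exists U; split => // n E; have := Um n.+1; rewrite E => /principal_filterP /=.
by rewrite ltnn.
Qed.

(** A fixed ultrafilter suffices: the [k]-th chain runs through the first [k]
    bars in the directions given by [B], so that the order recovers [B]. *)
Lemma card_orders_ge : ([set: set nat] #<= ultrafilter_orders d)%card.
Proof.
have [U [UU Un Um]] := nonprincipal_ultrafilter.
have UF : ProperFilter U by apply: ultra_proper.
have ex (B : set nat) k : exists s : seq (set (S3 R)),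
    [/\ is_chain s, covers s, (mesh d s <= (k.+1%:R^-1)%:E)%E &
    forall n, (n < k)%N -> (chain_le s (bot R n) (top R n) <-> n \in B)].
  exact: (@chain_with_bars (fun n => n \in B) k _ (invn_gt0 R (ltn0Sn k))).
have [D DP] := choice (fun Bk => ex Bk.1 Bk.2).
pose r (B : set nat) := ultra_le (fun k => D (B, k)) U.
have rP B n : r B (bot R n) (top R n) <-> B n.
  have [Bn|Bn] := pselect (B n); split => //.
    move=> _; apply: filterS (Um n.+1) => k nk /=.
    by have [_ _ _ /(_ n nk)[_]] := DP (B, k); apply; exact: mem_set.
  move=> rn; have [k [/= nk kn]] := filter_ex (filterI (Um n.+1) rn).
  by have [_ _ _ /(_ n nk)[/(_ kn) + _]] := DP (B, k); rewrite inE.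
have rin B : ultrafilter_orders d (r B).
  exists (fun k => D (B, k)), U; split => //.
    by move=> k; have [] := DP (B, k).
  apply: (@squeeze_cvge _ _ _ _ (fun=> 0%E) _ (fun k => (k.+1%:R^-1)%:E)).
  - apply: nearW => k; have [_ _ -> _] := DP (B, k); rewrite andbT.
    exact: bigmax_ge_id.
  - exact: cvg_cst.
  - by apply: cvg_EFin; [exact: nearW|exact: cvg_harmonic].
apply/pcard_leP/injfunPex; exists r; first by move=> B _; exact: rin.
move=> B B' _ _ E; apply/funext => n; apply/propext.
by rewrite -!rP E.
Qed.

End LowerBound.

Theorem theorem4p10 (R : realType) (d : S3 R -> S3 R -> R)
    (hd : generating_metric d) :
  (ultrafilter_orders d #= [set: set nat])%card.
Proof.
by rewrite card_eq_le card_orders_le // card_orders_ge.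
Qed.
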